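(* Let $0<a<b<\infty$, $0<c<d<\infty$, $p,q>-1$ and $\alpha,\beta>0$. If $f:[a,b]\times[c,d]\to\mathbb{R}$ is of bounded variation in the sense of Arzelà, then the mixed Katugampola fractional integral ${}^{(p,q)}_{(a,c)}\mathfrak{I}^{(\alpha,\beta)}f$ is also of bounded variation in the sense of Arzelà on $[a,b]\times[c,d]$.
   Context: For $f:[a,b]\times[c,d]\to\mathbb{R}$ with $0<a<b$, $0<c<d$, real $\alpha,\beta>0$ and $(p,q)\neq(-1,-1)$, the mixed (left-hand sided) Katugampola fractional integral of $f$ is $$\big({}^{(p,q)}_{(a,c)}\mathfrak{I}^{(\alpha,\beta)}f\big)(x,y)=\frac{(p+1)^{1-\alpha}(q+1)^{1-\beta}}{\Gamma(\alpha)\Gamma(\beta)}\int_a^x\int_c^y (x^{p+1}-s^{p+1})^{\alpha-1}(y^{q+1}-t^{q+1})^{\beta-1}s^{p}t^{q}f(s,t)\,\mathrm{d}t\,\mathrm{d}s.$$ A function $f:[a,b]\times[c,d]\to\mathbb{R}$ is of bounded variation in the sense of Arzelà if there is a constant $K$ such that for every $m\in\mathbb{N}$ and all points $a=x_0\le x_1\le\dots\le x_m=b$, $c=y_0\le y_1\le\dots\le y_m=d$, one has $\sum_{i=0}^{m-1}|f(x_{i+1},y_{i+1})-f(x_i,y_i)|\le K$. Equivalently, $f=f_1-f_2$ with $f_1,f_2$ bounded and nondecreasing in each variable separately. *)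

(* Defs.v *)
From HB Require Import structures.
From mathcomp Require Import all_boot all_order all_algebra.
From mathcomp Require Import all_classical all_reals all_analysis.
Set Implicit Arguments. Unset Strict Implicit. Unset Printing Implicit Defensive.
Import Order.TTheory GRing.Theory Num.Theory.
Local Open Scope classical_set_scope.
Local Open Scope ring_scope.

Definition Gamma {R : realType} (x : R) : R :=
  Rintegral (@lebesgue_measure R) `]0, +oo[%classic
    (fun t => t `^ (x - 1) * expR (- t)).

Definition katugampola {R : realType} (p q alpha beta a c : R)
    (f : R -> R -> R) (x y : R) : R :=
  ((p + 1) `^ (1 - alpha) * (q + 1) `^ (1 - beta)) / (Gamma alpha * Gamma beta) *
  Rintegral (@lebesgue_measure R) `[a, x]%classic (fun s =>
    Rintegral (@lebesgue_measure R) `[c, y]%classic (fun t =>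
      (x `^ (p + 1) - s `^ (p + 1)) `^ (alpha - 1) *
      (y `^ (q + 1) - t `^ (q + 1)) `^ (beta - 1) *
      s `^ p * t `^ q * f s t)).

Definition arzela_bv {R : realType} (a b c d : R) (f : R -> R -> R) : Prop :=
  exists K : R, forall (m : nat) (xs ys : nat -> R),
    xs 0%N = a -> xs m = b -> ys 0%N = c -> ys m = d ->
    (forall i : nat, (i < m)%N -> xs i <= xs i.+1) ->
    (forall i : nat, (i < m)%N -> ys i <= ys i.+1) ->
    \sum_(i < m) `| f (xs i.+1) (ys i.+1) - f (xs i) (ys i) | <= K.

(* Main.v *)
Require Import Defs.
From mathcomp Require Import all_boot all_order all_algebra.
From mathcomp Require Import all_classical all_reals all_analysis.
From mathcomp Require Import ring lra.
From mathcomp Require Import measurable_realfun.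
Import Order.TTheory GRing.Theory Num.Theory.
Import numFieldNormedType.Exports.
Local Open Scope classical_set_scope.
Local Open Scope ring_scope.

(** As in the classical Jordan decomposition, the variation along chains issued
    from [(a, c)] writes [f] as a difference of nonnegative functions that are
    nondecreasing in each variable, so it is enough to see that the Katugampola
    integral maps such functions to functions nondecreasing in each variable:
    chain sums then telescope, and the sign of the Gamma prefactor is irrelevant.
    The double integral is an iterate of one-variable operators
    [J x g = \int_a^x w_x(s) g(s) ds] with
    [w_x(s) = (x^(p+1) - s^(p+1))^(alpha-1) s^p], and for [g] nonnegative and
    nondecreasing [J x g] is nondecreasing in [x]. For [alpha >= 1] this is
    pointwise; for [alpha < 1] the weights decrease in [x] on the common interval
    while their mass [(x^(p+1) - a^(p+1))^alpha / (alpha (p+1))] increases, so the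
    mass lost on [[a, x]], where [g <= g x], is compensated on [[x, x']], where
    [g >= g x]. *)

(** * The one-variable kernel and operator *)

Definition katugampola_weight {R : realType} (p alpha x s : R) : R :=
  (x `^ (p + 1) - s `^ (p + 1)) `^ (alpha - 1) * s `^ p.

(** Up to the constant [(p + 1)^(1 - alpha) / Gamma alpha], this is the one-dimensional Katugampola
    integral of [g]. *)
Definition katugampola1 {R : realType} (p alpha a x : R) (g : R -> R) : R :=
  \int[@lebesgue_measure R]_(s in `[a, x]) (katugampola_weight p alpha x s * g s).

Lemma katugampola_weight_ge0 {R : realType} (p alpha x s : R) :
  0 <= katugampola_weight p alpha x s.
Proof. by rewrite mulr_ge0// powR_ge0. Qed.

Lemma measurable_katugampola_weight {R : realType} (p alpha x : R) (D : set R) :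
  measurable_fun D (katugampola_weight p alpha x).
Proof.
apply: (@measurable_funS _ _ _ _ setT) => //.
apply: measurable_funM => //.
apply: (measurableT_comp (measurable_powR _)) => //.
exact: measurable_funB.
Qed.

(** * Antiderivative and total mass of the weight *)

Section weight_antiderivative.
Context {R : realType}.
Variables (p alpha x : R).
Hypotheses (hp : -1 < p) (halpha : 0 < alpha) (x0 : 0 < x).

Let P0 : 0 < p + 1. Proof. by rewrite -ltrBlDr sub0r. Qed.

Let lt_pow (s : R) : 0 <= s -> s < x -> 0 < x `^ (p + 1) - s `^ (p + 1).
Proof.
move=> s0 sx; rewrite subr_gt0; apply: gt0_ltr_powR => //.
by rewrite nnegrE ltW.
Qed.

(** Antiderivative of the weight on []0, x[], normalised to vanish at [x]. *)
Let F (s : R) : R := - ((x `^ (p + 1) - s `^ (p + 1)) `^ alpha / (alpha * (p + 1))).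

Let is_derive_base (s : R) : 0 < s ->
  is_derive s 1 (fun s : R => x `^ (p + 1) - s `^ (p + 1)) (- ((p + 1) * s `^ p)).
Proof.
move=> s0; have := is_derive1_powR (p + 1) s0.
rewrite (_ : p + 1 - 1 = p); last by ring.
move=> H; have := is_deriveB (is_derive_cst (x `^ (p + 1)) s 1) H; by rewrite sub0r.
Qed.

Let is_derive_F (s : R) : 0 < s -> s < x -> is_derive s 1 F (katugampola_weight p alpha x s).
Proof.
move=> s0 sx; have Hb := is_derive_base s s0.
have H1 := @is_derive1_comp _ (@powR R ^~ alpha)
  (fun s => x `^ (p + 1) - s `^ (p + 1)) s _ _
  (is_derive1_powR alpha (lt_pow s (ltW s0) sx)) Hb.
have -> : F = (fun s => (- (alpha * (p + 1))^-1) *: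
   ((@powR R ^~ alpha) \o (fun s => x `^ (p + 1) - s `^ (p + 1))) s).
  by apply/funext => t; rewrite /F /= /GRing.scale /= mulNr mulrC.
apply: is_derive_eq.
rewrite /katugampola_weight /GRing.scale /=.
field; rewrite ?lt0r_neq0//.
Qed.

Let derivable_weight (s : R) : 0 < s -> s < x -> derivable (katugampola_weight p alpha x) s 1.
Proof.
move=> s0 sx; have Hb := is_derive_base s s0.
have H1 := @is_derive1_comp _ (@powR R ^~ (alpha - 1))
  (fun s => x `^ (p + 1) - s `^ (p + 1)) s _ _
  (is_derive1_powR (alpha - 1) (lt_pow s (ltW s0) sx)) Hb.
have H2 := is_derive1_powR p s0.
by apply: derivableM; apply: ex_derive.
Qed.

Local Notation mu := (@lebesgue_measure R).

(** For [alpha < 1] the weight is unbounded near [x], so the fundamental theorem of calculus is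
    applied only up to some [y < x]. *)
Let integral_weight_before a y : 0 < a -> a < y -> y < x ->
  (\int[mu]_(s in `[a, y]) (katugampola_weight p alpha x s)%:E = (F y - F a)%:E)%E.
Proof.
move=> a0 ay yx; have dF : {in `[a, y], forall s, derivable F s 1}.
  move=> s /[!in_itv]/= /andP[as_ sy].
  have H := is_derive_F s (lt_le_trans a0 as_) (le_lt_trans sy yx).
  exact: ex_derive.
rewrite EFinB (@continuous_FTC2 _ _ F) //.
- apply: derivable_within_continuous => s /[!in_itv]/= /andP[as_ sy].
  exact: derivable_weight (lt_le_trans a0 as_) (le_lt_trans sy yx).
- have /(continuous_within_itvP _ ay)[_ Fa Fy] := derivable_within_continuous dF.
  by split; [move=> s say; apply: dF; exact: subset_itv_oo_cc say|exact: Fa|exact: Fy].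
- move=> s /[!in_itv]/= /andP[as_ sy].
  have H := is_derive_F s (lt_trans a0 as_) (lt_trans sy yx).
  by rewrite derive1E derive_val.
Qed.

Let cvg_F : F (x - n.+1%:R^-1) @[n --> \oo] --> (0 : R).
Proof.
have hx : (x - n.+1%:R^-1 : R) @[n --> \oo] --> x.
  rewrite -[X in _ --> X]subr0; apply: cvgB; first exact: cvg_cst.
  exact: cvg_harmonic.
rewrite -oppr0; apply: cvgN; rewrite -(mul0r (alpha * (p + 1))^-1).
apply: cvgMl.
pose b s := x `^ (p + 1) - s `^ (p + 1).
have cb : {for x, continuous b}.
  apply: differentiable_continuous; apply/derivable1_diffP.
  by have H := is_derive_base x x0; apply: ex_derive.
have hb : b (x - n.+1%:R^-1) @[n --> \oo] --> (0 : R).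
  have bx : b x = 0 by rewrite /b subrr.
  by rewrite -[X in _ --> X]bx; exact: (cvg_comp _ _ hx cb).
(* [powR_cvg0] is a limit from the right at 0, so the base must be eventually positive; it is as
   soon as [x - n.+1%:R^-1] is nonnegative. *)
apply: (@cvg_comp _ _ _ (fun n => b (x - n.+1%:R^-1)) (@powR R ^~ alpha) _ (0^'+) _ _ (powR_cvg0 halpha)).
move=> A A0; suff: \forall n \near \oo, A (b (x - n.+1%:R^-1)) by [].
near=> n.
have : b (x - n.+1%:R^-1) > 0.
  apply: lt_pow; last by rewrite ltrBlDr ltrDl.
  by near: n; apply: (cvgr_ge x hx) => //.
near: n; exact: (hb _ A0).
Unshelve. all: by end_near. Qed.

(** Monotone convergence along the intervals [[a, x - 1/(n+1)]], which exhaust [[a, x[]; the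
    boundary term of [F] at the right end tends to 0. *)
Lemma integral_katugampola_weight_bndo a : 0 < a -> a < x ->
  (\int[mu]_(s in `[a, x[) (katugampola_weight p alpha x s)%:E =
   ((x `^ (p + 1) - a `^ (p + 1)) `^ alpha / (alpha * (p + 1)))%:E)%E.
Proof.
move=> a0 ax; rewrite (itv_bnd_open_bigcup true a x).
have hmono : nondecreasing_seq (fun n => `[a, x - n.+1%:R^-1]%classic : set R).
  move=> m n mn; rewrite subsetEset => s /=; rewrite !in_itv/= => /andP[-> /le_trans]; apply.
  by rewrite lerD2l lerN2 lef_pV2// ?posrE// ler_nat.
have C1 : ((\int[mu]_(s in `[a, (x - n.+1%:R^-1)%R]%classic) (katugampola_weight p alpha x s)%:E)%E
    @[n --> \oo] --> (\int[mu]_(s in \bigcup_n `[a, (x - n.+1%:R^-1)%R]%classic)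
      (katugampola_weight p alpha x s)%:E)%E).
  apply: (@ge0_nondecreasing_set_cvg_integral _ (measurableTypeR R) R
    (fun n => `[a, x - n.+1%:R^-1]%classic) _ lebesgue_measure hmono) => [n|n|n s _].
  - exact: measurable_itv.
  - by apply/measurable_EFinP; exact: measurable_katugampola_weight.
  - by rewrite lee_fin katugampola_weight_ge0.
have hx : (x - n.+1%:R^-1 : R) @[n --> \oo] --> x.
  rewrite -[X in _ --> X]subr0; apply: cvgB; first exact: cvg_cst.
  exact: cvg_harmonic.
apply: (cvg_unique _ C1) => //.
have C2 : (F (x - n.+1%:R^-1) - F a)%:E @[n --> \oo] --> (0 - F a)%:E.
  by apply: cvg_EFin; [exact: nearW|apply: cvgB; [exact: cvg_F|exact: cvg_cst]].
have Fa : 0 - F a = (x `^ (p + 1) - a `^ (p + 1)) `^ alpha / (alpha * (p + 1)).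
  by rewrite sub0r opprK.
rewrite Fa in C2.
(* The closed form holds only for large [n]: for small [n] the right end may lie below [a]. *)
apply: cvg_trans C2; apply: near_eq_cvg; near=> n; apply/esym.
apply: integral_weight_before => //; last by rewrite ltrBlDr ltrDl.
by near: n; apply: (cvgr_gt x hx).
Unshelve. all: by end_near. Qed.

End weight_antiderivative.

(** * Linear operations on integrable real-valued functions *)

Section integrable_real.
Context d {T : measurableType d} {R : realType} (mu : {measure set T -> \bar R}).
Variables (D : set T) (mD : measurable D).

Lemma integrable_EFinZ (k : R) (h : T -> R) : mu.-integrable D (EFin \o h) ->
  mu.-integrable D (EFin \o (fun s => k * h s)).
Proof. by move=> ih; exact: (integrableZl _ k ih). Qed.

Lemma integrable_EFinB (g h : T -> R) : mu.-integrable D (EFin \o g) ->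
  mu.-integrable D (EFin \o h) -> mu.-integrable D (EFin \o (fun s => g s - h s)).
Proof. by move=> ig ih; exact: (integrableB _ ig ih). Qed.

End integrable_real.

(** * Monotonicity of the one-variable operator *)

Section one_variable.
Context {R : realType}.
Variables (p alpha a : R).
Hypotheses (hp : -1 < p) (halpha : 0 < alpha) (a0 : 0 < a).
Local Notation mu := (@lebesgue_measure R).
Local Notation w := (katugampola_weight p alpha).
Local Notation J := (katugampola1 p alpha a).

Lemma integral_katugampola_weight (x : R) : a <= x ->
  (\int[mu]_(s in `[a, x]) (w x s)%:E =
   ((x `^ (p + 1) - a `^ (p + 1)) `^ alpha / (alpha * (p + 1)))%:E)%E.
Proof.
rewrite le_eqVlt => /predU1P[<-|ax].
  by rewrite set_itv1 integral_set1 subrr powR0 ?mul0r// gt_eqF.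
rewrite -integral_itv_bndo_bndc; last first.
  by apply/measurable_EFinP; exact: measurable_katugampola_weight.
by rewrite integral_katugampola_weight_bndo// (lt_trans a0).
Qed.

(** The weight is nonnegative and its integral has just been found finite. *)
Lemma integrable_katugampola_weight (x : R) :
  mu.-integrable `[a, x] (EFin \o w x).
Proof.
have [xa|ax] := ltP x a.
  by rewrite set_itv_ge ?bnd_simp -?ltNge//; exact: integrable_set0.
apply/integrableP; split.
  by apply/measurable_EFinP; exact: measurable_katugampola_weight.
under eq_integral => s _ do rewrite /= ger0_norm ?katugampola_weight_ge0//.
by rewrite integral_katugampola_weight// ltry.
Qed.

Lemma Rintegral_katugampola_weight (x : R) : a <= x ->
  \int[mu]_(s in `[a, x]) w x s =
  (x `^ (p + 1) - a `^ (p + 1)) `^ alpha / (alpha * (p + 1)).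
Proof. by move=> ax; rewrite /Rintegral integral_katugampola_weight. Qed.

Lemma Rintegral_katugampola_weight_le (x x' : R) : a <= x -> x <= x' ->
  \int[mu]_(s in `[a, x]) w x s <= \int[mu]_(s in `[a, x']) w x' s.
Proof.
move=> ax xx'; have P0 : 0 < p + 1 by rewrite -ltrBlDr sub0r.
have x0 := lt_le_trans a0 ax.
have hpow u v : a <= u -> u <= v -> u `^ (p + 1) <= v `^ (p + 1).
  move=> au uv; have u0 := lt_le_trans a0 au.
  by apply: ge0_ler_powR => //; rewrite ?nnegrE ltW// (lt_le_trans u0).
have ax' := le_trans ax xx'.
rewrite (Rintegral_katugampola_weight _ ax) (Rintegral_katugampola_weight _ ax').
apply: ler_wpM2r; first by rewrite invr_ge0 (ltW (mulr_gt0 halpha P0)).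
apply: ge0_ler_powR; first exact: ltW.
- by rewrite nnegrE subr_ge0 hpow.
- by rewrite nnegrE subr_ge0 hpow.
- by rewrite lerD2r hpow.
Qed.

(** On [[a, x]] the function [g] is measurable and bounded by [g x]. The weight has its own
    parameter [x'] because [w x] and [w x'] are later compared on the same interval. *)
Lemma integrable_katugampola_weightM (x x' : R) (g : R -> R) : x <= x' ->
  {homo g : s t / s <= t} -> (forall s, 0 <= g s) ->
  mu.-integrable `[a, x] (EFin \o (fun s => w x' s * g s)).
Proof.
move=> xx' hg g0.
rewrite (_ : EFin \o _ = ((EFin \o w x') \* (EFin \o g))%E)//.
apply: integrableMl => //.
- apply: (integrableS _ _ _ (integrable_katugampola_weight x')) => //.
  by apply: subset_itvl; rewrite bnd_simp.
- exact: nondecreasing_measurable.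
- exists (g x); split; first by rewrite num_real.
  move=> M gM s /=; rewrite in_itv/= => /andP[_ sx].
  by rewrite ger0_norm// (le_trans (hg _ _ sx))// ltW.
Qed.

Lemma katugampola1_ge0 (x : R) (g : R -> R) : (forall s, 0 <= g s) -> 0 <= J x g.
Proof.
by move=> g0; apply: Rintegral_ge0 => s _; rewrite mulr_ge0// katugampola_weight_ge0.
Qed.

Lemma le_katugampola1 (x : R) (g h : R -> R) :
  {homo g : s t / s <= t} -> (forall s, 0 <= g s) ->
  {homo h : s t / s <= t} -> (forall s, 0 <= h s) ->
  (forall s, g s <= h s) -> J x g <= J x h.
Proof.
move=> hg g0 hh h0 gh; apply: le_Rintegral => //.
- exact: integrable_katugampola_weightM.
- exact: integrable_katugampola_weightM.
- by move=> s _; rewrite ler_wpM2l// katugampola_weight_ge0.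
Qed.

Lemma katugampola_weight_homo (x x' s : R) : 1 <= alpha ->
  0 <= s -> s <= x -> x <= x' -> w x s <= w x' s.
Proof.
move=> alpha1 s0 sx xx'; have P0 : 0 <= p + 1 by rewrite -lerBlDr sub0r ltW.
have hpow u v : 0 <= u -> u <= v -> u `^ (p + 1) <= v `^ (p + 1).
  by move=> u0 uv; apply: ge0_ler_powR => //; rewrite nnegrE// (le_trans u0).
have x0 := le_trans s0 sx; have x'0 := le_trans x0 xx'.
apply: ler_wpM2r; first exact: powR_ge0.
apply: ge0_ler_powR; first by rewrite subr_ge0.
- by rewrite nnegrE subr_ge0 hpow.
- by rewrite nnegrE subr_ge0 hpow// (le_trans sx).
- by rewrite lerD2r hpow.
Qed.

(** The base grows with [x] and the exponent is nonpositive. Strictness of [s < x] matters: for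
    [alpha < 1], [powR] sends base 0 to 0, so [w x x = 0] while [w x' x] is positive when
    [0 < x < x']. *)
Lemma katugampola_weight_nhomo (x x' s : R) : alpha <= 1 ->
  0 <= s -> s < x -> x <= x' -> w x' s <= w x s.
Proof.
move=> alpha1 s0 sx xx'; have P0 : 0 < p + 1 by rewrite -ltrBlDr sub0r.
have x0 := le_lt_trans s0 sx; have x'0 := lt_le_trans x0 xx'.
have b0 : 0 < x `^ (p + 1) - s `^ (p + 1).
  by rewrite subr_gt0 gt0_ltr_powR// nnegrE ltW.
have bb' : x `^ (p + 1) - s `^ (p + 1) <= x' `^ (p + 1) - s `^ (p + 1).
  by rewrite lerD2r ge0_ler_powR// ?nnegrE ltW.
have b'0 := lt_le_trans b0 bb'.
have e1 : alpha - 1 = - (1 - alpha) by rewrite opprB.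
apply: ler_wpM2r; first exact: powR_ge0.
rewrite e1 !powRN lef_pV2 ?posrE; [|exact: powR_gt0|exact: powR_gt0].
by apply: ge0_ler_powR; [rewrite subr_ge0|rewrite nnegrE ltW|rewrite nnegrE ltW|].
Qed.

Lemma katugampola1_homo (x x' : R) (g : R -> R) : a <= x -> x <= x' ->
  {homo g : s t / s <= t} -> (forall s, 0 <= g s) -> J x g <= J x' g.
Proof.
have arith (u u' v n n' t k : R) :
    k * (t - n') <= u' - v -> u - v <= k * (n - n') -> k * n <= k * t -> u <= u'.
  by lra.
move=> ax xx' hg g0.
have xx'b : (BRight x <= BRight x')%O by rewrite bnd_simp.
have axb : (BLeft a <= BRight x)%O by rewrite bnd_simp.
have ig u : x <= u -> mu.-integrable `[a, x] (EFin \o (fun s => w u s * g s)).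
  by move=> xu; exact: integrable_katugampola_weightM.
have ig' : mu.-integrable `[a, x'] (EFin \o (fun s => w x' s * g s)).
  exact: integrable_katugampola_weightM.
have iw u : x <= u -> mu.-integrable `[a, x] (EFin \o w u).
  move=> xu; apply: (integrableS _ _ _ (integrable_katugampola_weight u)) => //.
  by apply: subset_itvl; rewrite bnd_simp.
have iw' := integrable_katugampola_weight x'.
have sub : `]x, x']%classic `<=` `[a, x']%classic.
  by apply: subset_itvr; rewrite bnd_simp.
have := Rintegral_itvB ig' axb xx'b.
have := Rintegral_itvB iw' axb xx'b.
rewrite -/(J x' g) => eqw eqg.
have [alpha1|alpha1] := leP 1 alpha.
  have le1 : J x g <= \int[mu]_(s in `[a, x]) (w x' s * g s).
    apply: le_Rintegral; [by []|exact: ig|exact: ig|].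
    move=> s /=; rewrite in_itv/= => /andP[as_ sx].
    apply: ler_wpM2r; first exact: g0.
    by apply: katugampola_weight_homo => //; rewrite (le_trans _ as_) ?ltW.
  apply: (le_trans le1); rewrite -subr_ge0 eqg.
  by apply: Rintegral_ge0 => s _; rewrite mulr_ge0// katugampola_weight_ge0.
have mass := Rintegral_katugampola_weight_le x x' ax xx'.
have tail : g x * \int[mu]_(s in `]x, x']) w x' s <=
    \int[mu]_(s in `]x, x']) (w x' s * g s).
  rewrite -RintegralZl//; last exact: integrableS iw'.
  apply: le_Rintegral; [by []| |exact: integrableS ig'|].
    by apply: integrable_EFinZ => //; exact: integrableS iw'.
  move=> s /=; rewrite in_itv/= => /andP[xs _].
  rewrite mulrC; apply: ler_wpM2l; first exact: katugampola_weight_ge0.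
  by apply: hg; exact: ltW.
have iBg := @integrable_EFinB _ (measurableTypeR R) R mu _ (measurable_itv _) _ _ (ig x (lexx x)) (ig x' xx').
have iBw := @integrable_EFinB _ (measurableTypeR R) R mu _ (measurable_itv _) _ _ (iw x (lexx x)) (iw x' xx').
have front : \int[mu]_(s in `[a, x]) (w x s * g s - w x' s * g s) <=
    \int[mu]_(s in `[a, x]) (g x * (w x s - w x' s)).
  apply: le_Rintegral; [by []| | |].
  - exact: iBg.
  - apply: integrable_EFinZ => //; exact: iBw.
  move=> s /=; rewrite in_itv/= => /andP[as_].
  (* At [s = x] the weights need not be ordered, but both sides coincide since [g s = g x]. *)
  rewrite le_eqVlt => /predU1P[->|sx]; first by rewrite -mulrBl mulrC.
  rewrite -mulrBl mulrC; apply: ler_wpM2r; last by apply: hg; exact: ltW.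
  rewrite subr_ge0; apply: katugampola_weight_nhomo => //; first exact: ltW.
  by rewrite (le_trans _ as_) ?ltW.
move: front; rewrite (RintegralB _ (ig x (lexx x)) (ig x' xx')); last exact: measurable_itv.
rewrite (RintegralZl _ _ iBw); last exact: measurable_itv.
rewrite (RintegralB _ (iw x (lexx x)) (iw x' xx')); last exact: measurable_itv.
move=> front.
have {}front : J x g - \int[mu]_(s in `[a, x]) (w x' s * g s) <=
    g x * (\int[mu]_(s in `[a, x]) w x s - \int[mu]_(s in `[a, x]) w x' s).
  exact: front.
rewrite -eqw -eqg in tail.
exact: (arith _ _ _ _ _ _ _ tail front (ler_wpM2l (g0 x) mass)).
Qed.

End one_variable.

(** * Chains and the Arzelà variation *)

Lemma chain_le {R : realType} (m : nat) (xs : nat -> R) :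
  (forall i, (i < m)%N -> xs i <= xs i.+1) ->
  forall i j, (i <= j <= m)%N -> xs i <= xs j.
Proof.
move=> mono i; elim=> [|j IH] /andP[]; first by rewrite leqn0 => /eqP->.
rewrite leq_eqVlt => /predU1P[->//|ij] jm.
by rewrite (le_trans (IH _) (mono _ jm))// -ltnS ij ltnW.
Qed.

Section arzela_chains.
Context {R : realType}.
Implicit Types (a b c d x y : R) (f g : R -> R -> R).

Definition is_chain (a b : R) (m : nat) (xs : nat -> R) : Prop :=
  [/\ xs 0%N = a, xs m = b & forall i, (i < m)%N -> xs i <= xs i.+1].

Definition chain_sum (f : R -> R -> R) (m : nat) (xs ys : nat -> R) : R :=
  \sum_(i < m) `|f (xs i.+1) (ys i.+1) - f (xs i) (ys i)|.

Definition chain_sums (f : R -> R -> R) (a c x y : R) : set R :=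
  [set v | exists m xs ys, [/\ is_chain a x m xs, is_chain c y m ys &
    v = chain_sum f m xs ys]].

(** Counterpart of Jordan's variation function. The real [sup] is meaningful only where
    [has_sup_chain_sums] applies. *)
Definition arzela_variation (f : R -> R -> R) (a c x y : R) : R :=
  sup (chain_sums f a c x y).

Definition chain_rcons (m : nat) (xs : nat -> R) (x : R) (i : nat) : R :=
  if (i <= m)%N then xs i else x.

Lemma is_chain_rcons a x x' m xs : is_chain a x m xs -> x <= x' ->
  is_chain a x' m.+1 (chain_rcons m xs x').
Proof.
move=> [xs0 xsm mono] xx'; rewrite /chain_rcons; split.
- by [].
- by rewrite ltnn.
move=> i; rewrite ltnS => im; rewrite im; case: (ltnP i m) => [/mono//|mi].
have -> : i = m by apply/eqP; rewrite eqn_leq mi im.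
by rewrite xsm.
Qed.

Lemma chain_sum_rcons f m xs ys x y :
  chain_sum f m.+1 (chain_rcons m xs x) (chain_rcons m ys y) =
  chain_sum f m xs ys + `|f x y - f (xs m) (ys m)|.
Proof.
rewrite /chain_sum big_ord_recr /= /chain_rcons leqnn ltnn; congr (_ + _).
by apply: eq_bigr => i _ /=; rewrite (ltn_ord i) (ltnW (ltn_ord i)).
Qed.

Lemma chain_sums_rcons f a c x y x' y' v : x <= x' -> y <= y' ->
  chain_sums f a c x y v -> chain_sums f a c x' y' (v + `|f x' y' - f x y|).
Proof.
move=> xx' yy' [m [xs [ys [hx hy ->]]]].
exists m.+1, (chain_rcons m xs x'), (chain_rcons m ys y'); split.
- exact: is_chain_rcons hx xx'.
- exact: is_chain_rcons hy yy'.
- by case: hx hy => _ xm _ [_ ym _]; rewrite chain_sum_rcons xm ym.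
Qed.

Lemma chain_sums_start f a c : chain_sums f a c a c 0.
Proof.
exists 0%N, (fun=> a), (fun=> c); split.
- by split.
- by split.
- by rewrite /chain_sum big_ord0.
Qed.

(** * Jordan decomposition for the Arzelà variation *)

Section jordan.
Variables (a b c d : R) (f : R -> R -> R).
Hypotheses (ab : a <= b) (cd : c <= d) (bv : arzela_bv a b c d f).
Local Notation V := (arzela_variation f a c).

(** One more point extends a chain ending at [(x, y)] to one ending at [(b, d)], so the bound [K]
    for the whole rectangle serves here too. *)
Lemma has_sup_chain_sums x y : a <= x -> x <= b -> c <= y -> y <= d ->
  has_sup (chain_sums f a c x y).
Proof.
move=> ax xb cy yd; split.
  by exists (0 + `|f x y - f a c|); apply: chain_sums_rcons => //; exact: chain_sums_start.
have [K hK] := bv; exists K => v /(@chain_sums_rcons _ _ _ _ _ b d _ xb yd).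
move=> [m [xs [ys [[x0 xm mx] [y0 ym my] e]]]].
by have := hK m xs ys x0 xm y0 ym mx my; rewrite -/(chain_sum f m xs ys) -e; apply: le_trans; rewrite lerDl.
Qed.

(** Append [(x', y')] to each chain ending at [(x, y)] and take suprema. This makes both [V] and
    [V - f] nondecreasing. *)
Lemma arzela_variation_increment x y x' y' :
  a <= x -> x <= x' -> x' <= b -> c <= y -> y <= y' -> y' <= d ->
  V x y + `|f x' y' - f x y| <= V x' y'.
Proof.
move=> ax xx' xb cy yy' yd.
have [ne _] := has_sup_chain_sums x y ax (le_trans xx' xb) cy (le_trans yy' yd).
have hs' := has_sup_chain_sums x' y' (le_trans ax xx') xb (le_trans cy yy') yd.
rewrite -lerBrDr; apply: ge_sup => // v hv; rewrite lerBrDr.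
by apply: sup_upper_bound => //; exact: chain_sums_rcons.
Qed.

Lemma arzela_variation_ge0 x y : a <= x -> x <= b -> c <= y -> y <= d -> 0 <= V x y.
Proof.
move=> ax xb cy yd; have := has_sup_chain_sums x y ax xb cy yd.
move=> hs; apply: (@le_trans _ _ (0 + `|f x y - f a c|)); first by rewrite add0r.
by apply: sup_upper_bound => //; apply: chain_sums_rcons => //; exact: chain_sums_start.
Qed.

(* The summands are precomposed with the projection onto the rectangle, so that
   monotonicity and positivity hold on the whole plane. *)
Lemma arzela_bv_decomposition : exists f1 f2 : R -> R -> R,
  [/\ forall x, {homo f1 x : y y' / y <= y'},
      forall y, {homo f1 ^~ y : x x' / x <= x'} & forall x y, 0 <= f1 x y] /\
  [/\ forall x, {homo f2 x : y y' / y <= y'},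
      forall y, {homo f2 ^~ y : x x' / x <= x'} & forall x y, 0 <= f2 x y] /\
  forall x y, a <= x -> x <= b -> c <= y -> y <= d -> f x y = f1 x y - f2 x y.
Proof.
pose px x := Num.max a (Num.min x b); pose py y := Num.max c (Num.min y d).
have px_ge x : a <= px x by rewrite le_max lexx.
have px_le x : px x <= b by rewrite ge_max ab ge_min lexx orbT.
have py_ge y : c <= py y by rewrite le_max lexx.
have py_le y : py y <= d by rewrite ge_max cd ge_min lexx orbT.
have px_homo : {homo px : x x' / x <= x'}.
  move=> x x' xx'; rewrite /px ge_max !le_max lexx/=.
  by rewrite le_min !ge_min xx' lexx /= !orbT.
have py_homo : {homo py : y y' / y <= y'}.
  move=> y y' yy'; rewrite /py ge_max !le_max lexx/=.
  by rewrite le_min !ge_min yy' lexx /= !orbT.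
have incr x x' y y' : x <= x' -> y <= y' ->
    V (px x) (py y) + `|f (px x') (py y') - f (px x) (py y)| <= V (px x') (py y').
  by move=> xx' yy'; apply: arzela_variation_increment => //; [exact: px_homo|exact: py_homo].
(* The shift makes the second function nonnegative: [V] dominates [f - f a c], hence
   [V - f >= - f a c >= - |f a c|]. Adding it to both functions preserves their difference. *)
exists (fun x y => V (px x) (py y) + `|f a c|),
  (fun x y => V (px x) (py y) - f (px x) (py y) + `|f a c|).
have h1 x x' y y' : x <= x' -> y <= y' -> V (px x) (py y) <= V (px x') (py y').
  by move=> xx' yy'; have := incr _ _ _ _ xx' yy'; apply: le_trans; rewrite lerDl.
have h2 x x' y y' : x <= x' -> y <= y' ->
   V (px x) (py y) - f (px x) (py y) <= V (px x') (py y') - f (px x') (py y').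
  move=> xx' yy'; have := incr _ _ _ _ xx' yy'.
  have := ler_norm (f (px x') (py y') - f (px x) (py y)); lra.
split; last split.
- split=> [x y y' yy'|y x x' xx'|x y]; rewrite ?lerD2r ?h1//.
  by rewrite addr_ge0// arzela_variation_ge0.
- split=> [x y y' yy'|y x x' xx'|x y]; rewrite ?lerD2r ?h2//.
  have := arzela_variation_increment a c (px x) (py y)
    (lexx _) (px_ge x) (px_le x) (lexx _) (py_ge y) (py_le y).
  have := arzela_variation_ge0 a c (lexx _) ab (lexx _) cd.
  have := ler_norm (f (px x) (py y) - f a c).
  have := ler_norm (f a c); lra.
- move=> x y ax xb cy yd.
  have -> : px x = x by rewrite /px min_l// max_r.
  have -> : py y = y by rewrite /py min_l// max_r.
  by ring.
Qed.

End jordan.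

(** Each increment of [f] is at most [|k|] times that of [g1 + g2], and the latter telescope along
    any chain. *)
Lemma arzela_bv_of_monotone a b c d (k : R) f g1 g2 :
  (forall x x' y y', a <= x -> x <= x' -> c <= y -> y <= y' -> g1 x y <= g1 x' y') ->
  (forall x x' y y', a <= x -> x <= x' -> c <= y -> y <= y' -> g2 x y <= g2 x' y') ->
  (forall x y, a <= x -> x <= b -> c <= y -> y <= d -> f x y = k * (g1 x y - g2 x y)) ->
  arzela_bv a b c d f.
Proof.
move=> h1 h2 hf; exists (`|k| * ((g1 b d - g1 a c) + (g2 b d - g2 a c))).
move=> m xs ys x0 xm y0 ym mx my.
have xa i : (i <= m)%N -> a <= xs i by move=> im; rewrite -x0 (chain_le m).
have xb i : (i <= m)%N -> xs i <= b by move=> im; rewrite -xm (chain_le m)// im leqnn.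
have yc i : (i <= m)%N -> c <= ys i by move=> im; rewrite -y0 (chain_le m).
have yd i : (i <= m)%N -> ys i <= d by move=> im; rewrite -ym (chain_le m)// im leqnn.
pose g i := g1 (xs i) (ys i) + g2 (xs i) (ys i).
have -> : g1 b d - g1 a c + (g2 b d - g2 a c) = g m - g 0%N.
  by rewrite /g x0 xm y0 ym; ring.
rewrite -telescope_sumr// big_mkord mulr_sumr; apply: ler_sum => i _.
have im := ltn_ord i; have im' := ltnW im.
rewrite !hf; [|exact: xa|exact: xb|exact: yc|exact: yd|exact: xa|exact: xb|exact: yc|exact: yd].
rewrite -mulrBr normrM ler_wpM2l//.
have := h1 _ _ _ _ (xa _ im') (mx _ im) (yc _ im') (my _ im).
have := h2 _ _ _ _ (xa _ im') (mx _ im) (yc _ im') (my _ im).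
by rewrite /g => ? ?; rewrite ler_norml; apply/andP; split; lra.
Qed.

End arzela_chains.

(** * The double integral as an iterate of one-variable operators *)

Section two_variables.
Context {R : realType}.
Variables (p q alpha beta a c : R).
Hypotheses (hp : -1 < p) (hq : -1 < q) (halpha : 0 < alpha) (hbeta : 0 < beta)
  (a0 : 0 < a) (c0 : 0 < c).

Definition katugampola2 (f : R -> R -> R) (x y : R) : R :=
  katugampola1 p alpha a x (fun s => katugampola1 q beta c y (f s)).

Section monotone.
Variable f : R -> R -> R.
Hypotheses (f_homo2 : forall x, {homo f x : y y' / y <= y'})
  (f_homo1 : forall y, {homo f ^~ y : x x' / x <= x'}) (f0 : forall x y, 0 <= f x y).

(** Makes the inner integral an admissible integrand for the outer operator. *)
Lemma katugampola1_slice_homo (y : R) :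
  {homo (fun s => katugampola1 q beta c y (f s)) : s t / s <= t}.
Proof. by move=> s t st; apply: le_katugampola1 => // u; exact: f_homo1. Qed.

Lemma katugampola2_homo (x x' y y' : R) : a <= x -> x <= x' -> c <= y -> y <= y' ->
  katugampola2 f x y <= katugampola2 f x' y'.
Proof.
move=> ax xx' cy yy'; have J0 z s : 0 <= katugampola1 q beta c z (f s).
  exact: katugampola1_ge0.
(* First [x] moves, by monotonicity of the outer operator in its endpoint; then [y] moves, by
   comparing the inner integrals pointwise. *)
apply: (@le_trans _ _ (katugampola2 f x' y)).
  apply: katugampola1_homo; [exact: hp|exact: halpha|exact: a0|exact: ax|exact: xx'| |].
    exact: katugampola1_slice_homo.
  exact: J0.
apply: le_katugampola1; [exact: hp|exact: halpha|exact: a0| | | | |].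
- exact: katugampola1_slice_homo.
- exact: J0.
- exact: katugampola1_slice_homo.
- exact: J0.
move=> s; apply: katugampola1_homo; [exact: hq|exact: hbeta|exact: c0|exact: cy|exact: yy'| |].
  exact: f_homo2.
exact: f0.
Qed.

End monotone.

(** Linearity in both integrations, valid because each monotone piece is integrable against its
    weight; the factor depending on [s] alone leaves the inner integral. *)
Lemma katugampola_decomposition (f f1 f2 : R -> R -> R) (x y : R) :
  (forall s, {homo f1 s : t t' / t <= t'}) ->
  (forall t, {homo f1 ^~ t : s s' / s <= s'}) -> (forall s t, 0 <= f1 s t) ->
  (forall s, {homo f2 s : t t' / t <= t'}) ->
  (forall t, {homo f2 ^~ t : s s' / s <= s'}) -> (forall s t, 0 <= f2 s t) ->
  (forall s t, a <= s -> s <= x -> c <= t -> t <= y -> f s t = f1 s t - f2 s t) ->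
  katugampola p q alpha beta a c f x y =
  ((p + 1) `^ (1 - alpha) * (q + 1) `^ (1 - beta)) / (Gamma alpha * Gamma beta) *
  (katugampola2 f1 x y - katugampola2 f2 x y).
Proof.
(* Regroups the kernel into the two weights: [u], [v] are the powers of differences, [s], [t] the
   factors [s^p], [t^q], and [k], [l] the values of [f1], [f2]. *)
have arith (u v s t k l : R) :
  u * v * s * t * (k - l) = u * s * (v * t * k - v * t * l) by ring.
move=> f1y f1x f1p f2y f2x f2p hf; rewrite /katugampola; congr (_ * _).
rewrite -RintegralB//; first last.
- apply: integrable_katugampola_weightM => //; first exact: katugampola1_slice_homo.
  by move=> s; exact: katugampola1_ge0.
- apply: integrable_katugampola_weightM => //; first exact: katugampola1_slice_homo.
  by move=> s; exact: katugampola1_ge0.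
apply: eq_Rintegral => s; rewrite inE/= in_itv/= => /andP[as_ sx].
have i1 := integrable_katugampola_weightM _ _ _ hq hbeta c0 _ _ _ (lexx y) (f1y s) (f1p s).
have i2 := integrable_katugampola_weightM _ _ _ hq hbeta c0 _ _ _ (lexx y) (f2y s) (f2p s).
rewrite -mulrBr -RintegralB// -RintegralZl//; last exact: integrable_EFinB.
apply: eq_Rintegral => t; rewrite inE/= in_itv/= => /andP[ct ty].
by rewrite (hf s t as_ sx ct ty); exact: arith.
Qed.

End two_variables.

Theorem mainTheorem3 (R : realType) (a b c d p q alpha beta : R)
  (f : R -> R -> R) :
  0 < a -> a < b -> 0 < c -> c < d -> -1 < p -> -1 < q ->
  0 < alpha -> 0 < beta ->
  arzela_bv a b c d f ->
  arzela_bv a b c d (katugampola p q alpha beta a c f).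
Proof.
move=> a0 ab c0 cd hp hq halpha hbeta bv.
have [f1 [f2 [[f1y f1x f1p] [[f2y f2x f2p] hf]]]] :=
  arzela_bv_decomposition a b c d f (ltW ab) (ltW cd) bv.
apply: (arzela_bv_of_monotone a b c d _ _ (katugampola2 p q alpha beta a c f1)
  (katugampola2 p q alpha beta a c f2)).
- by move=> *; exact: katugampola2_homo.
- by move=> *; exact: katugampola2_homo.
move=> x y ax xb cy yd; apply: katugampola_decomposition => // s t as_ sx ct ty.
by apply: hf => //; [exact: le_trans xb|exact: le_trans yd].
Qed.
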